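(* Let $s\in\mathbb{C}$ with $\Re(s)>1$ and let $z$ be a primitive $q$-th root of unity with $q\ge 1$. Let $k\ge 2$ be an integer of the form $k=bq+1$ for some positive integer $b$. Then $$\sum_{d\mid k}\frac{\mu(d)}{d^s}\mathrm{Li}_{z^d}(s)=\sum_{\substack{1\le h\le k\\ (h,k)=1}}z^hh^{-s}+\sum_{m\ge 0}\frac{(-1)^mP_m(s)\,\mathrm{Li}_z(s+m)}{k^{s+m}}\sum_{\substack{1\le h\le k\\ (h,k)=1}}z^hh^m,$$ and $$\sum_{d\mid k}\frac{\mu(d)}{d^s}\mathrm{Li}_{z^d}(s)=\sum_{m\ge 0}\frac{P_m(s)\,\mathrm{Li}_z(s+m)}{k^{s+m}}\sum_{\substack{1\le h\le k\\ (h,k)=1}}z^{-h}h^m .$$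
   Context: For a root of unity $w$ and $\Re(s)>1$, $\mathrm{Li}_w(s):=\sum_{n\ge1}\frac{w^n}{n^s}$. For $m\ge 0$, $P_0(s)=1$ and $P_m(s)=\frac{s(s+1)\cdots(s+m-1)}{m!}$ for $m\ge1$. $\mu$ is the Möbius function and $(h,k)$ denotes the greatest common divisor of $h$ and $k$. *)

(* Defs.v *)
From HB Require Import structures.
From mathcomp Require Import all_boot all_order all_algebra.
From mathcomp Require Import all_classical all_reals all_analysis.
From mathcomp Require Import complex.

Set Implicit Arguments.
Unset Strict Implicit.
Unset Printing Implicit Defensive.

Import Order.TTheory GRing.Theory Num.Theory.
Import numFieldNormedType.Exports.

Local Open Scope classical_set_scope.
Local Open Scope ring_scope.
Local Open Scope complex_scope.

(* The complex numbers are R[i]; limits of complex sequences are taken in the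
   regular module R[i]^o, whose topology is the one of the modulus. *)

Definition cexp (R : realType) (w : R[i]) : R[i] :=
  (expR (complex.Re w))%:C * (cos (complex.Im w) +i* sin (complex.Im w)).

(* n^s = exp (s ln n); only meaningful for n > 0. *)
Definition cpown (R : realType) (n : nat) (s : R[i]) : R[i] :=
  cexp (s * (ln (n%:R : R))%:C).

(* The terms are indexed from 0, so the k-th one is w^(k+1) / (k+1)^s.  The
   value is the sum of the series only where it converges, in particular for
   w a root of unity and Re s > 1. *)
Definition Li (R : realType) (w s : R[i]) : R[i] :=
  limn (series (fun k => w ^+ k.+1 / cpown k.+1 s : R[i]^o)).

Definition rising_coef (R : realType) (m : nat) (s : R[i]) : R[i] :=
  (\prod_(i < m) (s + i%:R)) / (m`!)%:R.

(* Moebius function; only meaningful for n > 0. *)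
Definition mobius (n : nat) : int :=
  if all (fun p => ~~ (p ^ 2 %| n)%N) (primes n)
  then (-1) ^+ size (primes n) else 0.

(* Main.v *)
Require Import Defs.
From mathcomp Require Import all_boot all_order all_algebra.
From mathcomp Require Import all_classical all_reals all_analysis.
From mathcomp Require Import complex.
From mathcomp Require Import ring lra zify.

Import Order.TTheory GRing.Theory Num.Theory.
Import numFieldNormedType.Exports.

Local Open Scope classical_set_scope.
Local Open Scope ring_scope.
Local Open Scope complex_scope.

Set Implicit Arguments.
Unset Strict Implicit.
Unset Printing Implicit Defensive.

Import Normc.

(** Both formulas come from summing [z ^ n * n ^ (- s)] over the [n] coprime to
    [k] in two ways.

    Summing over the divisors of [k] first: since the Moebius function sums to
    the indicator of [1] over the divisors of an integer, the weight
    [\sum_(d | k, d | n) mu d] selects the [n] coprime to [k], and the terms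
    with [d | n] form the series of [Li (z ^ d) s / d ^ s]. Hence the left-hand
    side is the sum over the [n] coprime to [k] ([coprime_series_cvg]).

    Summing over residue classes: cut the integers into blocks of length [k].
    As [z ^ k = z], an integer [n = j k + h] contributes
    [z ^ j * z ^ h * (j k + h) ^ (- s)], and [n = j k - h] contributes
    [z ^ j * z ^ - h * (j k - h) ^ (- s)]. The two theorems correspond to these
    two ways of naming a residue class coprime to [k]; in the first one the
    block [j = 0] is kept apart and gives the finite sum. For [0 < h < k] put
    [y = h / k] or [y = - h / k], so that [`|y| < 1]. What remains is the Taylor
    expansion of the Lerch zeta function ([Lerch_expansion])

      [\sum_(j >= 1) z ^ j * (j + y) ^ (- s)
        = \sum_(m >= 0) (-1) ^ m * P_m(s) * Li z (s + m) * y ^ m].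

    This is the binomial series of [(1 + y / j) ^ (- s)] summed over [j]. The
    two summations are exchanged through uniformity: for [`|x| <= r < 1] the
    [n]-th partial sum of the binomial series is within [e n] of
    [(1 + x) ^ (- s)], where [e] tends to [0] and does not depend on [x]
    ([binomial_series_unif]). The [n]-th partial sum of the right-hand side is
    then within [e n * \sum_j j ^ (- Re s)] of the left-hand side.

    The uniform bound is obtained from a differential equation rather than from
    power series: the derivative of [(1 + t x) ^ s] times the [n]-th partial sum
    at [t x] telescopes to a single term ([is_cderive_binomial_partial]), which
    is small because [n * P_n(s) * r ^ n] tends to [0]
    ([binom_coef_vanish]). *)

(** * Sequences and series of complex numbers *)

Section ComplexSequences.
Variable R : realType.
Implicit Types (u v : nat -> R[i]^o) (x y l : R[i]).

Lemma normrE x : `|x| = (normc x)%:C. Proof. by []. Qed.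

Lemma normc_ge0 x : 0 <= normc x.
Proof. by rewrite -lecR -normrE normr_ge0. Qed.

Lemma normc_real (a : R) : normc a%:C = `|a|.
Proof. by rewrite /normc /= expr0n /= addr0 sqrtr_sqr. Qed.

Lemma normcX x n : normc (x ^+ n) = normc x ^+ n.
Proof. by apply: (@complexI R); rewrite -normrE normrX rmorphXn. Qed.

Lemma normc_sum (I : Type) (r : seq I) (P : pred I) (F : I -> R[i]) :
  normc (\sum_(i <- r | P i) F i) <= \sum_(i <- r | P i) normc (F i).
Proof. by rewrite -lecR -normrE rmorph_sum; apply: ler_norm_sum. Qed.

Lemma normc_Re x : `|complex.Re x| <= normc x.
Proof. by rewrite -lecR; apply: normc_ge_Re. Qed.

Lemma normc_Im x : `|complex.Im x| <= normc x.
Proof.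
case: x => a b /=; rewrite -sqrtr_sqr ler_wsqrtr// lerDr sqr_ge0//.
Qed.

Lemma normc_le_ReIm x : normc x <= `|complex.Re x| + `|complex.Im x|.
Proof.
case: x => a b /=.
rewrite -(ler_pXn2r (n := 2)) ?nnegrE ?sqrtr_ge0 ?addr_ge0//.
rewrite sqr_sqrtr ?addr_ge0 ?sqr_ge0// sqrrD !real_normK ?num_real//.
by rewrite addrAC lerDl mulrn_wge0// mulr_ge0.
Qed.

(** The norm of [R[i]] takes values in [R[i]] itself. This reduces limits of
    complex sequences to limits of real ones, where squeezing is available. *)
Lemma cvg_normcP u l :
  u @ \oo --> (l : R[i]^o) <-> (fun n => normc (u n - l)) @ \oo --> (0 : R).
Proof.
split=> [/cvgrPdist_lt ul|/cvgrPdist_lt ul].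
  apply/cvgrPdist_lt => e e0.
  have : 0 < e%:C :> R[i] by rewrite ltcR.
  move=> /ul; apply: filterS => n.
  by rewrite distrC normrE ltcR !(sub0r, normrN) ger0_norm ?normc_ge0.
apply/cvgrPdist_lt => -[e f]; rewrite ltcE /= => /andP[/eqP -> e0].
have := ul _ e0; apply: filterS => n.
by rewrite sub0r normrN ger0_norm ?normc_ge0 // [`|l - _|]distrC normrE ltcR.
Qed.

Lemma cvg_ReIm u l : complex.Re (u n) @[n --> \oo] --> complex.Re l ->
  complex.Im (u n) @[n --> \oo] --> complex.Im l -> u @ \oo --> (l : R[i]^o).
Proof.
move=> ur ui; apply/cvg_normcP.
apply: (@squeeze_cvgr _ _ _ _ (cst 0)
  (fun n => `|complex.Re (u n) - complex.Re l| +
            `|complex.Im (u n) - complex.Im l|)).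
- near=> n; rewrite normc_ge0 /=.
  by apply: le_trans (normc_le_ReIm _) _; case: (u n) (l) => [a b] [c d].
- exact: cvg_cst.
- rewrite -[0]addr0; apply: cvgD.
    apply/norm_cvg0P; rewrite -(subrr (complex.Re l)).
    by apply: cvgB => //; exact: cvg_cst.
  apply/norm_cvg0P; rewrite -(subrr (complex.Im l)).
  by apply: cvgB => //; exact: cvg_cst.
Unshelve. all: by end_near. Qed.

Lemma Re_sum (I : Type) (r : seq I) (P : pred I) (F : I -> R[i]) :
  complex.Re (\sum_(i <- r | P i) F i) = \sum_(i <- r | P i) complex.Re (F i).
Proof. by apply: (big_morph (@complex.Re R)) => // -[a b] [c d]. Qed.

Lemma Im_sum (I : Type) (r : seq I) (P : pred I) (F : I -> R[i]) :
  complex.Im (\sum_(i <- r | P i) F i) = \sum_(i <- r | P i) complex.Im (F i).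
Proof. by apply: (big_morph (@complex.Im R)) => // -[a b] [c d]. Qed.

Lemma is_cvg_series_mull (c : R) (v : R ^nat) :
  cvgn (series v) -> cvgn (series (fun n => c * v n)).
Proof.
move=> cv; rewrite (_ : series _ = (fun n => c * series v n)).
  exact: (cvgP _ (cvgMl_tmp cv)).
by apply/funext => n; rewrite /series /= mulr_sumr.
Qed.

(** The real and the imaginary part are absolutely convergent real series, so
    completeness is only needed in [R]. *)
Lemma is_cvg_series_normc u (v : R ^nat) :
  (forall n, normc (u n) <= v n) -> cvgn (series v) -> cvgn (series u).
Proof.
move=> uv cv.
have absc (f : R ^nat) : (forall n, `|f n| <= v n) -> cvgn (series f).
  move=> fv; apply: normed_cvg; apply: (series_le_cvg _ _ _ cv) => // n /=.
    exact: normr_ge0.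
  exact: le_trans (normr_ge0 (f n)) (fv n).
have cr : cvgn (series (fun n => complex.Re (u n))).
  by apply: absc => n; apply: le_trans (normc_Re _) _.
have ci : cvgn (series (fun n => complex.Im (u n))).
  by apply: absc => n; apply: le_trans (normc_Im _) _.
apply/cvg_ex; exists ((limn (series (fun n => complex.Re (u n)))) +i*
  (limn (series (fun n => complex.Im (u n))))).
apply: cvg_ReIm => /=.
  by under eq_cvg do rewrite /series /= Re_sum; exact: cr.
by under eq_cvg do rewrite /series /= Im_sum; exact: ci.
Qed.

Lemma normc_limn_le u l (B : R) : u @ \oo --> (l : R[i]^o) ->
  (forall n, normc (u n) <= B) -> normc l <= B.
Proof.
move=> ul uB; rewrite -[B]addr0.
apply: (@cvgr_to_ge _ eventually _ _ (fun n => B + normc (u n - l))).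
  by apply: cvgD; [exact: cvg_cst|apply/cvg_normcP].
near=> n; rewrite -[l in X in X <= _](subKr (u n)).
by apply: le_trans (le_normcD _ _) _; rewrite normcN lerD.
Unshelve. all: by end_near. Qed.

Lemma cvgn_sum (I : Type) (r : seq I) (P : pred I) (f : I -> nat -> R[i]^o)
    (l : I -> R[i]^o) : (forall i, P i -> f i @ \oo --> l i) ->
  (fun n => \sum_(i <- r | P i) f i n : R[i]^o) @ \oo -->
  (\sum_(i <- r | P i) l i : R[i]^o).
Proof.
move=> fl; elim: r => [|i r IHr].
  by under eq_cvg do rewrite big_nil; rewrite big_nil; exact: cvg_cst.
under eq_cvg do rewrite big_cons; rewrite big_cons.
case: ifP => [Pi|_]; last exact: IHr.
apply: (@cvgD _ (R[i]^o : normedModType R[i])).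
  exact: fl.
exact: IHr.
Qed.

Lemma cvgn_mull (c : R[i]) (u : nat -> R[i]^o) (l : R[i]) :
  u @ \oo --> (l : R[i]^o) ->
  (fun n => c * u n : R[i]^o) @ \oo --> (c * l : R[i]^o).
Proof.
move=> ul.
exact: (@cvgZl_tmp _ (R[i]^o : normedModType R[i]) _ eventually _ c u l ul).
Qed.

Lemma cvgn_limE (u : nat -> R[i]^o) (l : R[i]) :
  u @ \oo --> (l : R[i]^o) -> limn u = l.
Proof. exact: cvg_lim. Qed.

Lemma cvgn_uniq (u : nat -> R[i]^o) (l l' : R[i]) :
  u @ \oo --> (l : R[i]^o) -> u @ \oo --> (l' : R[i]^o) -> l = l'.
Proof. by move=> /cvgn_limE <- /cvgn_limE. Qed.

End ComplexSequences.

(** * Complex powers and derivatives of complex-valued functions *)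

Section ComplexPowers.
Variable R : realType.
Implicit Types (x y : R) (s t : R[i]).

Lemma cexpD s t : cexp (s + t) = cexp s * cexp t.
Proof.
case: s t => [a b] [c d]; rewrite /cexp /= expRD cosD sinD.
by apply/eqP; rewrite eq_complex /=; apply/andP; split; apply/eqP; ring.
Qed.

Lemma cexp0 : cexp (0 : R[i]) = 1.
Proof. by rewrite /cexp /= expR0 cos0 sin0 mul1r. Qed.

Lemma normc_cexp s : normc (cexp s) = expR (complex.Re s).
Proof.
rewrite /cexp normcM normc_real ger0_norm ?expR_ge0 //.
by rewrite /= cos2Dsin2 sqrtr1 mulr1.
Qed.

(** Extends [cpown] to real bases, which the shifts [j + y] in the Lerch series
    require. *)
Definition cpow x s : R[i] := cexp (s * (ln x)%:C).

Lemma cpownE n s : cpown n s = cpow n%:R s. Proof. by []. Qed.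

Lemma cpowD x s t : cpow x (s + t) = cpow x s * cpow x t.
Proof. by rewrite /cpow mulrDl cexpD. Qed.

Lemma cpowr0 x : cpow x 0 = 1.
Proof. by rewrite /cpow mul0r cexp0. Qed.

Lemma cpow1l s : cpow 1 s = 1.
Proof. by rewrite /cpow ln1 mulr0 cexp0. Qed.

Lemma cpow_neq0 x s : cpow x s != 0.
Proof.
have h : cpow x (- s) * cpow x s = 1 by rewrite -cpowD addNr cpowr0.
by apply: contra_eqN h => /eqP ->; rewrite mulr0 eq_sym oner_eq0.
Qed.

Lemma cpowN x s : cpow x (- s) = (cpow x s)^-1.
Proof.
have h : cpow x (- s) * cpow x s = 1 by rewrite -cpowD addNr cpowr0.
by apply: (mulIf (cpow_neq0 x s)); rewrite h mulVf ?cpow_neq0.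
Qed.

Lemma cpowM x y s : 0 < x -> 0 < y -> cpow (x * y) s = cpow x s * cpow y s.
Proof.
by move=> x0 y0; rewrite /cpow lnM ?posrE // rmorphD /= mulrDr cexpD.
Qed.

Lemma cpowr1 x : 0 < x -> cpow x 1 = x%:C.
Proof.
move=> x0; rewrite /cpow mul1r /cexp /= lnK ?posrE // cos0 sin0.
exact: mulr1.
Qed.

Lemma cpowr_nat x n : 0 < x -> cpow x n%:R = x%:C ^+ n.
Proof.
move=> x0; elim: n => [|n IHn]; first by rewrite cpowr0.
by rewrite -addn1 natrD cpowD IHn cpowr1 // addn1 exprSr.
Qed.

Lemma normc_cpow x s : 0 < x -> normc (cpow x s) = x `^ complex.Re s.
Proof.
move=> x0; rewrite normc_cexp /powR gt_eqF //; congr expR.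
by case: s => a b /=; rewrite mulr0 subr0.
Qed.

Lemma ReD s t : complex.Re (s + t) = complex.Re s + complex.Re t.
Proof. by case: s t => [? ?] []. Qed.

Lemma ImD s t : complex.Im (s + t) = complex.Im s + complex.Im t.
Proof. by case: s t => [? ?] []. Qed.

Lemma ReN s : complex.Re (- s) = - complex.Re s.
Proof. by case: s. Qed.

Lemma ImN s : complex.Im (- s) = - complex.Im s.
Proof. by case: s. Qed.

Lemma ReM s t : complex.Re (s * t) =
  complex.Re s * complex.Re t - complex.Im s * complex.Im t.
Proof. by case: s t => [? ?] []. Qed.

Lemma ImM s t : complex.Im (s * t) =
  complex.Re s * complex.Im t + complex.Im s * complex.Re t.
Proof. by case: s t => [? ?] []. Qed.

(** Derivatives are taken along a real variable, so that the one-variable mean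
    value theorem applies to the real and imaginary parts. *)
Definition is_cderive (f : R -> R[i]) (x : R) (d : R[i]) :=
  is_derive x 1 (fun y => complex.Re (f y)) (complex.Re d) /\
  is_derive x 1 (fun y => complex.Im (f y)) (complex.Im d).

Lemma is_cderive_cst (c : R[i]) x : is_cderive (fun=> c) x 0.
Proof. by split; apply: is_derive_cst. Qed.

Lemma is_cderiveD f g x df dg : is_cderive f x df -> is_cderive g x dg ->
  is_cderive (fun y => f y + g y) x (df + dg).
Proof.
move=> [fr fi] [gr gi]; split.
  rewrite ReD.
  rewrite (_ : (fun y => _) =
      (fun y => complex.Re (f y)) + (fun y => complex.Re (g y))).
    exact: is_deriveD.
  by apply/funext => y /=; rewrite fctE ReD.
rewrite ImD.
rewrite (_ : (fun y => _) =
    (fun y => complex.Im (f y)) + (fun y => complex.Im (g y))).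
  exact: is_deriveD.
by apply/funext => y /=; rewrite fctE ImD.
Qed.

Lemma is_cderiveM f g x df dg : is_cderive f x df -> is_cderive g x dg ->
  is_cderive (fun y => f y * g y) x (df * g x + f x * dg).
Proof.
move=> [fr fi] [gr gi]; split.
  rewrite (_ : (fun y => _) =
       (fun y => complex.Re (f y)) * (fun y => complex.Re (g y))
     - (fun y => complex.Im (f y)) * (fun y => complex.Im (g y))); last first.
    by apply/funext => y; rewrite ReM.
  apply: (is_derive_eq (is_deriveB (is_deriveM fr gr) (is_deriveM fi gi))).
  rewrite ReD !ReM /GRing.scale /=; ring.
rewrite (_ : (fun y => _) =
       (fun y => complex.Re (f y)) * (fun y => complex.Im (g y))
     + (fun y => complex.Im (f y)) * (fun y => complex.Re (g y))); last first.
    by apply/funext => y; rewrite ImM.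
apply: (is_derive_eq (is_deriveD (is_deriveM fr gi) (is_deriveM fi gr))).
rewrite ImD !ImM /GRing.scale /=; ring.
Qed.

Lemma is_cderive_real (f : R -> R) x (df : R) : is_derive x 1 f df ->
  is_cderive (fun y => (f y)%:C) x df%:C.
Proof. by move=> fd; split => //=; exact: is_derive_cst. Qed.

Lemma is_cderive_cexp (f : R -> R) x (df : R) s : is_derive x 1 f df ->
  is_cderive (fun y => cexp (s * (f y)%:C)) x (s * df%:C * cexp (s * (f x)%:C)).
Proof.
move=> fd; case: s => a b.
have ed : is_derive x 1 (fun y => expR (a * f y)) (expR (a * f x) * (a * df)).
  apply: (@is_derive1_comp _ expR (fun y => a * f y)).
have cd : is_derive x 1 (fun y => cos (b * f y)) (- sin (b * f x) * (b * df)).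
  apply: (@is_derive1_comp _ cos (fun y => b * f y)).
have sd : is_derive x 1 (fun y => sin (b * f y)) (cos (b * f x) * (b * df)).
  apply: (@is_derive1_comp _ sin (fun y => b * f y)).
split.
  rewrite (_ : (fun y => _) =
      (fun y => expR (a * f y)) * (fun y => cos (b * f y))); last first.
    by apply/funext => y /=; rewrite fctE !mulr0 subr0 add0r mul0r subr0.
  apply: (is_derive_eq (is_deriveM ed cd)).
  rewrite /GRing.scale /= !mulr0 !mul0r !subr0 !add0r; ring.
rewrite (_ : (fun y => _) =
    (fun y => expR (a * f y)) * (fun y => sin (b * f y))); last first.
  by apply/funext => y /=; rewrite fctE !mulr0 subr0 add0r mul0r addr0.
apply: (is_derive_eq (is_deriveM ed sd)).
rewrite /GRing.scale /= !mulr0 !mul0r !subr0 !add0r; ring.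
Qed.

(** The mean value point differs between the real and the imaginary part, hence
    the factor 2. *)
Lemma cderive_le (f df : R -> R[i]) (B : R) :
  (forall t : R, 0 <= t <= 1 -> is_cderive f t (df t)) ->
  (forall t : R, 0 <= t <= 1 -> normc (df t) <= B) ->
  normc (f 1 - f 0) <= B *+ 2.
Proof.
move=> fd dB.
have mv (g dg : R -> R) :
  (forall t : R, 0 <= t <= 1 -> is_derive t 1 g (dg t)) ->
  (forall t : R, 0 <= t <= 1 -> `|dg t| <= B) -> `|g 1 - g 0| <= B.
  move=> gd dgB; have [||c c01 ->] := @MVT_segment _ g dg 0 1 ler01.
  - move=> t; rewrite in_itv /= => /andP[t0 t1].
    by apply: gd; rewrite !ltW.
  - apply: derivable_within_continuous => t; rewrite in_itv /= => t01.
    by have := gd _ t01 => -[].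
  - by rewrite subr0 mulr1 dgB // -in_itv.
apply: le_trans (normc_le_ReIm _) _; rewrite mulr2n lerD //.
  rewrite ReD ReN; apply: (mv (fun y => complex.Re (f y))
    (fun y => complex.Re (df y))) => t t01.
    by have [] := fd t t01.
  by apply: le_trans (normc_Re _) (dB _ t01).
rewrite ImD ImN; apply: (mv (fun y => complex.Im (f y))
  (fun y => complex.Im (df y))) => t t01.
  by have [] := fd t t01.
by apply: le_trans (normc_Im _) (dB _ t01).
Qed.

End ComplexPowers.

(** * The binomial series with a uniform remainder *)

Section BinomialSeries.
Variable R : realType.
Implicit Types (x : R) (s : R[i]).

(** The coefficient of [x ^ m] in the expansion of [(1 + x) ^ (- s)]. *)
Definition binom_coef (m : nat) s : R[i] := (-1) ^+ m * rising_coef m s.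

Lemma binom_coef0 s : binom_coef 0 s = 1.
Proof. by rewrite /binom_coef /rising_coef big_ord0 fact0 divr1 mulr1. Qed.

Lemma binom_coefS m s :
  m.+1%:R * binom_coef m.+1 s = - (s + m%:R) * binom_coef m s.
Proof.
rewrite /binom_coef /rising_coef big_ord_recr /= factS natrM invfM exprS.
have : (m.+1%:R : R[i]) != 0 by rewrite pnatr_eq0.
move: (m.+1%:R : R[i]) (m`!%:R^-1) => a f a0.
by field.
Qed.

(** Let [S(w)] be the partial sum, with [w = y x]. The recurrence on the
    coefficients cancels all of [(1 + w) S'(w) + s S(w)] but one monomial, and
    [(1 + w) ^ (s - 1)] times this expression is the derivative of
    [(1 + w) ^ s * S(w)]. So that product is almost constant, as it would be
    for the full series. *)
Lemma is_cderive_binomial_partial s x (n : nat) (y : R) : 0 < 1 + y * x ->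
  is_cderive (fun y => cpow (1 + y * x) s *
      \sum_(m < n) binom_coef m s * ((y * x) ^+ m)%:C) y
    (- (n%:R * binom_coef n s) * (x * (y * x) ^+ n.-1)%:C *
     cpow (1 + y * x) (s - 1)).
Proof.
move=> w0.
have dw : is_derive y 1 (fun y => 1 + y * x) x.
  by apply: is_derive_eq; rewrite /GRing.scale /=; ring.
have dP : is_cderive (fun y => cpow (1 + y * x) s) y
    (s * x%:C * cpow (1 + y * x) (s - 1)).
  have dl : is_derive y 1 (fun y => ln (1 + y * x)) ((1 + y * x)^-1 * x).
    have dln := is_derive1_ln w0.
    by apply: (@is_derive1_comp _ (@ln R) (fun y => 1 + y * x)).
  have := is_cderive_cexp s dl; rewrite -/(cpow _ s).
  by rewrite cpowD cpowN cpowr1 // rmorphM /= fmorphV; congr is_cderive; ring.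
have PE : cpow (1 + y * x) s = (1 + y * x)%:C * cpow (1 + y * x) (s - 1).
  by rewrite -(cpowr1 w0) -cpowD [1 + (s - 1)]addrC subrK.
elim: n => [|n IHn].
  rewrite mul0r oppr0 !mul0r.
  rewrite (_ : (fun y => _) = fun=> 0); first exact: is_cderive_cst.
  by apply/funext => r; rewrite big_ord0 mulr0.
rewrite (_ : (fun y => _) = fun y => cpow (1 + y * x) s *
      (\sum_(m < n) binom_coef m s * ((y * x) ^+ m)%:C) +
      cpow (1 + y * x) s * (binom_coef n s * ((y * x) ^+ n)%:C)); last first.
  by apply/funext => r; rewrite big_ord_recr /= mulrDr.
have dX : is_derive y 1 (fun y => (y * x) ^+ n) (n%:R * (y * x) ^+ n.-1 * x).
  have d1 : is_derive y 1 (fun y => y * x) x.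
    by apply: is_derive_eq; rewrite /GRing.scale /=; ring.
  rewrite (_ : (fun y => _) = (fun y => y * x) ^+ n); first exact: is_deriveX.
  by apply/funext => r; rewrite exprfctE.
have dT := is_cderiveM (is_cderive_cst (binom_coef n s) y) (is_cderive_real dX).
have := is_cderiveD IHn (is_cderiveM dP dT).
congr is_cderive; rewrite binom_coefS PE /=.
move: (binom_coef n s) (cpow _ _) => c P; clear.
rewrite !(rmorphM, rmorphD, rmorphXn, rmorph1, rmorph_nat) /=.
case: n => [|n] /=; rewrite ?exprS; ring.
Qed.

Lemma cvg_ratio_lt1 (u : R ^nat) (q : R) (N : nat) : 0 <= q < 1 ->
  (forall n, (N <= n)%N -> 0 <= u n) ->
  (forall n, (N <= n)%N -> u n.+1 <= q * u n) ->
  u @ \oo --> (0 : R).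
Proof.
move=> /andP[q0 q1] u0 uq; rewrite -(cvg_shiftn N).
have le n : u (n + N)%N <= u N * q ^+ n.
  elim: n => [|n IHn]; first by rewrite expr0 mulr1.
  rewrite addSn; apply: le_trans (uq _ (leq_addl _ _)) _.
  by rewrite exprS mulrCA ler_wpM2l.
apply: (@squeeze_cvgr _ _ _ _ (cst 0) (fun n => u N * q ^+ n)).
- by near=> n; rewrite le u0 //= leq_addl.
- exact: cvg_cst.
- by apply: cvg_geometric; rewrite ger0_norm.
Unshelve. all: by end_near. Qed.

Lemma normc_nat n : normc (n%:R : R[i]) = n%:R.
Proof. by rewrite -(rmorph_nat (real_complex R)) normc_real normr_nat. Qed.

(** The ratio of consecutive terms is [`|s + n| * r / n], which tends to
    [r < 1]. *)
Lemma binom_coef_vanish s (r : R) : 0 <= r < 1 ->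
  (fun n => normc (n%:R * binom_coef n s) * r ^+ n) @ \oo --> (0 : R).
Proof.
move=> /andP[r0 r1].
pose q := (1 + r) / 2; have q1 : q < 1 by rewrite /q; lra.
have q0 : 0 <= q by rewrite /q; lra.
have rq : 0 < q - r by rewrite /q; lra.
(* For n > N, `|s + n| * r <= (`|s| + n) * r <= q * n. *)
pose N := Num.truncn (normc s * r / (q - r)).
apply: (@cvg_ratio_lt1 _ q N.+1) => [|n _|n nN]; first by rewrite q0.
  by rewrite mulr_ge0 ?normc_ge0 ?exprn_ge0.
rewrite binom_coefS (normcM (- _)) (normcM n%:R) normcN normc_nat exprS.
set c := normc (binom_coef n s); set p := r ^+ n.
have cp0 : 0 <= c * p by rewrite mulr_ge0 ?normc_ge0 ?exprn_ge0.
have h1 : normc (s + n%:R) <= normc s + n%:R.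
  by apply: le_trans (le_normcD _ _) _; rewrite normc_nat.
have h2 : normc s * r <= n%:R * (q - r).
  rewrite -ler_pdivrMr //; apply: ltW.
  apply: (lt_le_trans (truncnS_gt _)); by rewrite ler_nat.
rewrite (_ : _ * _ * _ = (normc (s + n%:R) * r) * (c * p)); last by ring.
rewrite (_ : q * _ = (q * n%:R) * (c * p)); last by ring.
rewrite ler_wpM2r //; apply: le_trans (ler_wpM2r r0 h1) _.
by rewrite mulrDl; lra.
Qed.

Lemma powRN_le (a b r : R) : 0 <= r -> 0 < a <= b -> b `^ (- r) <= a `^ (- r).
Proof.
move=> r0 /andP[a0 ab].
rewrite !powRN lef_pV2 ?posrE ?powR_gt0 ?(lt_le_trans a0) //.
by rewrite ge0_ler_powR ?nnegrE // ltW // (lt_le_trans a0).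
Qed.

(** The product of [(1 + t x) ^ s] and the partial sum at [t x] equals [1] at
    [t = 0], and its derivative in [t] is small uniformly in [x]; integrating up
    to [t = 1] and dividing by [(1 + x) ^ s] gives the remainder. *)
Lemma binomial_series_unif s (r : R) : 1 <= complex.Re s -> 0 <= r < 1 ->
  exists2 e : R ^nat, e @ \oo --> (0 : R) &
  forall n x, `|x| <= r ->
    normc (\sum_(m < n.+1) binom_coef m s * x%:C ^+ m - cpow (1 + x) (- s))
    <= e n.
Proof.
move=> s1 /andP[r0 r1].
have q0 : 0 < 1 - r by rewrite subr_gt0.
(* 1 - r and 2 bound 1 + t x from below and above; the final factor 2 is the
   constant of the mean value inequality. *)
pose K := (1 - r) `^ (- complex.Re s) * (2 `^ (complex.Re s - 1)) *+ 2.
exists (fun n => K * (normc (n.+1%:R * binom_coef n.+1 s) * r ^+ n.+1)).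
  rewrite -[0](mulr0 K); apply: cvgMl_tmp.
  have := binom_coef_vanish s (r:=r); rewrite r0 r1 => /(_ isT).
  by rewrite -(cvg_shiftS _).
move=> n x xr.
have posw t : 0 <= t <= 1 ->
  (1 - r <= 1 + t * x) /\ (1 + t * x <= 2) /\ `|t * x| <= r.
  move=> /andP[t0 t1].
  have h : `|t * x| <= r.
    rewrite normrM (ger0_norm t0); apply: le_trans xr.
    by rewrite ler_piMl.
  by move: h; rewrite ler_norml => /andP[? ?]; split; lra.
(* G t = (1 + t x) ^ s * S(t x), and `|G 1 - G 0| is what must be small. *)
have dG t : 0 <= t <= 1 -> is_cderive _ t _ :=
  fun t01 => is_cderive_binomial_partial s n.+1 (lt_le_trans q0 (posw t t01).1).
set B := normc (n.+1%:R * binom_coef n.+1 s) * r ^+ n.+1 *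
  2 `^ (complex.Re s - 1).
have dB t : 0 <= t <= 1 -> normc (- (n.+1%:R * binom_coef n.+1 s) *
    (x * (t * x) ^+ n.+1.-1)%:C * cpow (1 + t * x) (s - 1)) <= B.
  move=> t01; have [w1 [w2 w3]] := posw t t01.
  rewrite normcM normc_cpow ?(lt_le_trans q0) // normcM normcN normc_real.
  apply: ler_pM; rewrite ?powR_ge0 ?mulr_ge0 ?normc_ge0 //.
    rewrite ler_wpM2l ?normc_ge0 // normrM normrX exprS ler_pM ?exprn_ge0 //.
    by rewrite lerXn2r ?nnegrE.
  rewrite ReD ReN /= ge0_ler_powR ?nnegrE ?subr_ge0 //; lra.
have := cderive_le dG dB; rewrite mul1r mul0r addr0 cpow1l mul1r.
rewrite [X in _ - X](_ : _ = 1); last first.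
  rewrite big_ord_recl big1 ?addr0 /= => [|i _].
    by rewrite binom_coef0 mulr1.
  by rewrite exprS mul0r mulr0.
move=> GB.
have wr : 1 - r <= 1 + x.
  by have := posw 1; rewrite mul1r ler01 lexx => /(_ isT) [].
have w0 : 0 < 1 + x := lt_le_trans q0 wr.
under eq_bigr do rewrite -rmorphXn /=.
rewrite (_ : _ - _ = cpow (1 + x) (- s) * (cpow (1 + x) s *
   \sum_(m < n.+1) binom_coef m s * (x ^+ m)%:C - 1)); last first.
  by rewrite mulrBr mulr1 mulrA -cpowD addNr cpowr0 mul1r.
rewrite normcM normc_cpow // ReN.
have -> : K * (normc (n.+1%:R * binom_coef n.+1 s) * r ^+ n.+1) =
    (1 - r) `^ (- complex.Re s) * (B *+ 2).
  by rewrite /K /B -2!mulrnAr -!mulrA; congr (_ * _); ring.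
apply: ler_pM; rewrite ?powR_ge0 ?normc_ge0 //.
by rewrite powRN_le ?q0 //; lra.
Qed.

End BinomialSeries.

(** * Taylor expansion of the Lerch zeta function *)

Section LerchExpansion.
Variable R : realType.
Implicit Types (x y : R) (s z : R[i]).

(** [a * (x + 1) ^ (- (a + 1))] is the derivative of [- x ^ (- a)] at [x + 1],
    and this derivative decreases. The proof factors [x] as
    [(x + 1) (1 - 1 / (x + 1))] and uses [ln (1 + u) <= u]. *)
Lemma powR_telescope_le (a x : R) : 0 < a -> 0 < x ->
  a * (x + 1) `^ (- (a + 1)) <= x `^ (- a) - (x + 1) `^ (- a).
Proof.
move=> a0 x0; have x1 : 0 < x + 1 by rewrite addr_gt0.
rewrite opprD powRD ?(gt_eqF x1) ?implybT // powR_inv1 ?(ltW x1) // lerBrDr.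
set P := (x + 1) `^ (- a).
have xE : x = (x + 1) * (1 - (x + 1)^-1).
  by rewrite mulrBr mulr1 mulfV ?gt_eqF // addrK.
have y1 : 0 < 1 - (x + 1)^-1 by rewrite subr_gt0 invf_lt1 // ltrDr.
rewrite [x in leRHS]xE powRM ?(ltW x1) ?(ltW y1) // -/P.
rewrite (_ : _ + P = P * (1 + a / (x + 1))); last by ring.
rewrite ler_wpM2l ?powR_ge0 // /powR (gt_eqF y1).
apply: le_trans (expR_ge1Dx _) _; rewrite ler_expR mulNr -mulrN.
rewrite ler_pM2l // lerNr.
by apply: le_ln1Dx; rewrite -subr_gt0 opprK addrC.
Qed.

(** With [a = r - 1], each term but the first is at most a difference of
    consecutive values of [x ^ (- a) / a], so the partial sums stay below
    [1 + a^-1]. *)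
Lemma is_cvg_series_powR (r : R) : 1 < r ->
  cvgn (series (fun n => n.+1%:R `^ (- r) : R)).
Proof.
move=> r1; pose a := r - 1; have a0 : 0 < a by rewrite subr_gt0.
have ub n : series (fun n => n.+1%:R `^ (- r) : R) n.+1 <=
    1 + (1 - n.+1%:R `^ (- a)) / a.
  elim: n => [|n IHn].
    by rewrite /series /= big_nat1 powR1 subrr mul0r addr0.
  rewrite seriesSr; apply: le_trans (lerD IHn (lexx _)) _.
  have := @powR_telescope_le a n.+1%:R a0 (ltr0Sn _ _).
  rewrite subrK natr1 -ler_pdivlMl // => h.
  apply: le_trans (lerD (lexx _) h) _.
  by rewrite -addrA lerD2l mulrC -mulrDr mulrC addrA subrK.
apply: nondecreasing_is_cvgn.
  by apply: nondecreasing_series => n _ _; exact: powR_ge0.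
exists (1 + a^-1) => _ [n _ <-].
have st : {homo series (fun n => n.+1%:R `^ (- r) : R) :
    n m / (n <= m)%N >-> n <= m}.
  by apply: nondecreasing_series => k _ _; exact: powR_ge0.
apply: le_trans (st _ _ (leqnSn n)) _; apply: le_trans (ub n) _.
by rewrite lerD2l -[leRHS]mul1r ler_wpM2r ?invr_ge0 ?(ltW a0) // gerBl powR_ge0.
Qed.

Lemma Li_cvg z s : normc z <= 1 -> 1 < complex.Re s ->
  series (fun k => z ^+ k.+1 / cpown k.+1 s : R[i]^o) @ \oo -->
  (Li z s : R[i]^o).
Proof.
move=> z1 s1; apply: is_cvg_series_normc (is_cvg_series_powR s1) => n.
rewrite normcM normcX normcV cpownE normc_cpow ?ltr0Sn // powRN.
by rewrite ler_piMl ?invr_ge0 ?powR_ge0 // exprn_ile1 ?normc_ge0.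
Qed.

(** Taylor expansion at [y = 0] of [\sum_j z ^ j (j + y) ^ (- s)]: its [m]-th
    derivative at [0] is a multiple of [Li z (s + m)]. Truncating the binomial
    series of [(1 + y / j) ^ (- s)] at order [n] costs at most [e n] for every
    [j], hence at most [e n * \sum_j j ^ (- Re s)] in the sum. *)
Lemma Lerch_expansion z s y : normc z <= 1 -> 1 < complex.Re s -> `|y| < 1 ->
  exists2 l : R[i]^o,
    series (fun j => z ^+ j.+1 * cpow (j.+1%:R + y) (- s) : R[i]^o)
      @ \oo --> l &
    series (fun m => binom_coef m s * Li z (s + m%:R) * y%:C ^+ m : R[i]^o)
      @ \oo --> l.
Proof.
move=> z1 s1 y1.
have s0 : 0 <= complex.Re s by lra.
have r01 : 0 <= `|y| < 1 by rewrite normr_ge0.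
have q0 : 0 < 1 - `|y| by rewrite subr_gt0.
pose x j : R := y / j.+1%:R.
have xy j : `|x j| <= `|y|.
  by rewrite normrM ler_piMr // ger0_norm ?invr_ge0 // invf_le1 ?ler1n.
have wx j : 1 - `|y| <= 1 + x j by have := xy j; rewrite ler_norml; lra.
have w0 j : 0 < 1 + x j by apply: lt_le_trans (wx j).
pose b j : R[i] := z ^+ j.+1 * cpow j.+1%:R (- s).
have bE j : z ^+ j.+1 * cpow (j.+1%:R + y) (- s) = b j * cpow (1 + x j) (- s).
  have xE : j.+1%:R * (1 + x j) = j.+1%:R + y.
    by rewrite mulrDr mulr1 /x mulrCA mulfV ?mulr1 // pnatr_eq0.
  by rewrite /b -mulrA -(cpowM _ (ltr0Sn _ j) (w0 j)) xE.
have bN j : normc (b j) <= j.+1%:R `^ (- complex.Re s).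
  rewrite normcM normcX normc_cpow ?ltr0Sn // ReN.
  by rewrite ler_piMl ?powR_ge0 // exprn_ile1 ?normc_ge0.
have zc := is_cvg_series_powR s1.
have cW :
    cvgn (series (fun j => z ^+ j.+1 * cpow (j.+1%:R + y) (- s) : R[i]^o)).
  apply: (@is_cvg_series_normc _ _
     (fun n => (1 - `|y|) `^ (- complex.Re s) * n.+1%:R `^ (- complex.Re s))).
    move=> n; rewrite bE normcM mulrC ler_pM ?normc_ge0 //.
    by rewrite normc_cpow // ReN powRN_le // q0 wx.
  exact: is_cvg_series_mull.
move: (cW) => /cvg_ex[W Wl]; exists W; first exact: Wl.
have [e e0 eb] := binomial_series_unif (ltW s1) r01.
have [Z Zb] : exists Z : R, forall n,
    series (fun n => n.+1%:R `^ (- complex.Re s) : R) n <= Z.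
  exists (limn (series (fun n => n.+1%:R `^ (- complex.Re s) : R))) => n.
  apply: nondecreasing_cvgn_le => //.
  by apply: nondecreasing_series => k _ _; exact: powR_ge0.
rewrite -cvg_shiftS; apply/cvg_normcP.
apply: (@squeeze_cvgr _ _ _ _ (cst 0) (fun n => e n * Z)).
- near=> n; rewrite normc_ge0 /=.
  have PN : (fun J => \sum_(j < J) b j *
        (\sum_(m < n.+1) binom_coef m s * (x j)%:C ^+ m) : R[i]^o) @ \oo -->
      (series (fun m => binom_coef m s * Li z (s + m%:R) * y%:C ^+ m : R[i]^o)
        n.+1).
    rewrite [X in _ --> X](_ : _ = \sum_(m < n.+1)
        (binom_coef m s * y%:C ^+ m) * Li z (s + m%:R)); last first.
      by rewrite /series /= big_mkord; apply: eq_bigr => m _; rewrite mulrAC.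
    rewrite (_ : (fun J => _) = (fun J => \sum_(m < n.+1)
        (binom_coef m s * y%:C ^+ m) *
        series (fun k => z ^+ k.+1 / cpown k.+1 (s + m%:R) : R[i]^o) J
        : R[i]^o)).
      apply: cvgn_sum => m _; apply: cvgn_mull; apply: Li_cvg => //.
      rewrite ReD; apply: lt_le_trans s1 _; rewrite lerDl.
      by rewrite -(rmorph_nat (real_complex R)) ler0n.
    apply/funext => J; rewrite /series /=.
    under [RHS]eq_bigr do rewrite big_mkord mulr_sumr.
    rewrite exchange_big; apply: eq_bigr => j _ /=; rewrite mulr_sumr.
    apply: eq_bigr => m _.
    rewrite cpownE cpowD cpowr_nat ?ltr0Sn // /b cpowN /x rmorphM fmorphV /=.
    by move: (cpow _ s) => P; rewrite exprMn exprVn invfM; ring.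
  apply: (normc_limn_le (cvgB PN Wl)) => J.
  change (normc (\sum_(j < J) b j * (\sum_(m < n.+1) binom_coef m s *
      (x j)%:C ^+ m) - \sum_(0 <= j < J) z ^+ j.+1 *
      cpow (j.+1%:R + y) (- s)) <= e n * Z).
  rewrite big_mkord -sumrB; apply: le_trans (normc_sum _ _ _) _.
  apply: le_trans (_ : e n * (\sum_(j < J) j.+1%:R `^ (- complex.Re s)) <= _).
    rewrite mulr_sumr; apply: ler_sum => j _.
    rewrite bE -mulrBr normcM mulrC ler_pM ?normc_ge0 //.
    exact: eb.
  rewrite ler_wpM2l //; last by have := Zb J; rewrite /series /= big_mkord.
  exact: le_trans (normc_ge0 _) (eb n _ (xy 0)).
- exact: cvg_cst.
- by rewrite -(mul0r Z); exact: cvgMr_tmp.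
Unshelve. all: by end_near. Qed.

End LerchExpansion.

(** * Moebius inversion: the sum over integers coprime to k *)

Section Mobius.

Lemma primes_pM (p d : nat) : prime p -> (0 < d)%N -> ~~ (p %| d)%N ->
  perm_eq (primes (p * d)%N) (p :: primes d).
Proof.
move=> pp d0 pd; apply: uniq_perm; first exact: primes_uniq.
  by rewrite /= primes_uniq mem_primes pp d0 (negbTE pd).
by move=> q; rewrite primesM ?(prime_gt0 pp) // (primes_prime pp) !inE.
Qed.

Lemma mobius_pM (p d : nat) : prime p -> (0 < d)%N -> ~~ (p %| d)%N ->
  mobius (p * d)%N = - mobius d.
Proof.
move=> pp d0 pd; have pm := primes_pM pp d0 pd.
rewrite /mobius (perm_size pm) (perm_all _ pm) /= exprS mulN1r.
rewrite expnS expn1 dvdn_pmul2l ?prime_gt0 // pd /=.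
have -> : all (fun p0 => ~~ (p0 ^ 2 %| p * d)%N) (primes d) =
          all (fun p0 => ~~ (p0 ^ 2 %| d)%N) (primes d).
  apply: eq_in_all => q; rewrite mem_primes => /and3P[qp _ qd].
  rewrite Gauss_dvdr // coprimeXl // prime_coprime // dvdn_prime2 //.
  by apply: contraNneq pd => <-.
by case: ifP => // _; rewrite oppr0.
Qed.

Lemma mobius_sqr0 (p d : nat) : prime p -> (0 < d)%N -> (p ^ 2 %| d)%N ->
  mobius d = 0.
Proof.
move=> pp d0 pd; rewrite /mobius; case: ifP => // /allP /(_ p).
rewrite pd /= mem_primes pp d0 (dvdn_trans _ pd) ?dvdn_exp //.
by move=> /(_ isT).
Qed.

(** Let [p] be the least prime factor of [g]. Pair a divisor [d] not divisible
    by [p] with the divisor [p d]: their Moebius values are opposite. The other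
    divisors are multiples of [p ^ 2] and contribute nothing. *)
Lemma sum_mobius_divisors (g : nat) : (0 < g)%N ->
  \sum_(d <- divisors g) mobius d = (g == 1%N)%:R.
Proof.
move=> g0; have [->|g1] := eqVneq g 1%N; first by rewrite big_seq1.
have pp : prime (pdiv g) by rewrite pdiv_prime // ltn_neqAle eq_sym g1.
have pg := pdiv_dvd g; set p := pdiv g in pp pg *.
rewrite (bigID (fun d => (p ^ 2 %| d)%N)) /=.
rewrite big_seq_cond big1 ?add0r => [|d /andP[]]; last first.
  rewrite -dvdn_divisors // => dg pd.
  by apply: (mobius_sqr0 pp) => //; exact: dvdn_gt0 dg.
rewrite (bigID (fun d => (p %| d)%N)) /= -big_filter.
have pm : perm_eq [seq d <- divisors g | ~~ (p ^ 2 %| d)%N & (p %| d)%N]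
    (map (muln p) [seq d <- divisors g | ~~ (p %| d)%N]).
  apply: uniq_perm; first by rewrite filter_uniq // divisors_uniq.
    rewrite map_inj_uniq ?filter_uniq ?divisors_uniq //.
    by move=> a b /eqP; rewrite eqn_pmul2l ?prime_gt0 // => /eqP.
  move=> d; rewrite mem_filter -dvdn_divisors //.
  apply/idP/mapP => [/andP[/andP[p2 /dvdnP[e de]] dg]|[e]].
    rewrite de in p2 dg *.
    exists e; last by rewrite mulnC.
    rewrite mem_filter -dvdn_divisors // (dvdn_trans _ dg) ?dvdn_mulr // andbT.
    by apply: contra p2; rewrite expnS expn1 => pe; exact: dvdn_mul.
  rewrite mem_filter -dvdn_divisors // => /andP[pe eg] ->.
  rewrite expnS expn1 dvdn_pmul2l ?prime_gt0 // pe dvdn_mulr //=.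
  by rewrite Gauss_dvd ?pg ?eg // prime_coprime.
rewrite (perm_big _ pm) /= big_map big_filter.
rewrite [X in _ + X](eq_bigl (fun d => ~~ (p %| d)%N)); last first.
  move=> d; case: (boolP (p %| d)%N) => pd; rewrite ?andbF // andbT.
  by apply: contra pd => h; rewrite (dvdn_trans _ h) ?dvdn_exp.
rewrite -big_split /= big_seq_cond big1 // => d /andP[].
rewrite -dvdn_divisors // => dg pd.
by rewrite mobius_pM ?addNr // (dvdn_gt0 _ dg).
Qed.

Lemma divisors_gcdn (n k : nat) : (0 < k)%N ->
  perm_eq [seq d <- divisors k | (d %| n)%N] (divisors (gcdn n k)).
Proof.
move=> k0; apply: uniq_perm; rewrite ?filter_uniq ?divisors_uniq // => d.
by rewrite mem_filter -!dvdn_divisors ?gcdn_gt0 ?k0 ?orbT // dvdn_gcd.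
Qed.

Lemma sum_mobius_coprime (n k : nat) : (0 < k)%N ->
  \sum_(d <- divisors k | (d %| n)%N) mobius d = (coprime n k)%:R.
Proof.
move=> k0; rewrite -big_filter (perm_big _ (divisors_gcdn n k0)) /=.
by rewrite sum_mobius_divisors // gcdn_gt0 k0 orbT.
Qed.

End Mobius.

Section CoprimeSeries.
Variable R : realType.
Implicit Types (s z : R[i]).

(** The partial sums of a series restricted to the multiples of [d] are partial
    sums of a full series, cut off at [n / d]. Limits can then be taken without
    rearranging any series. *)
Lemma sum_dvdn (V : nmodType) (F : nat -> V) (d n : nat) : (0 < d)%N ->
  \sum_(i < n | (d %| i.+1)%N) F i.+1 = \sum_(j < n %/ d) F (d * j.+1)%N.
Proof.
move=> d0; elim: n => [|n IHn]; first by rewrite div0n !big_ord0.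
rewrite big_mkcond big_ord_recr -big_mkcond /= IHn divnS //.
case: (boolP (d %| n.+1)%N) => dn; last by rewrite add0n addr0.
rewrite add1n big_ord_recr /=; congr (_ + F _).
have -> : (n %/ d).+1 = (n.+1 %/ d)%N by rewrite divnS // dn.
by rewrite mulnC divnK.
Qed.

Lemma cvg_divn (d : nat) : (0 < d)%N -> (fun n => (n %/ d)%N) @ \oo --> \oo.
Proof.
move=> d0; apply/cvgnyPge => A; near=> n; rewrite leq_divRL //.
by near: n; exact: nbhs_infty_ge.
Unshelve. all: by end_near. Qed.

Lemma Li_expr_cvg z s (d : nat) : (0 < d)%N -> normc z <= 1 ->
  1 < complex.Re s ->
  (fun n => \sum_(i < n | (d %| i.+1)%N) z ^+ i.+1 / cpown i.+1 s : R[i]^o)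
    @ \oo --> ((cpown d s)^-1 * Li (z ^+ d) s : R[i]^o).
Proof.
move=> d0 z1 s1.
have zd1 : normc (z ^+ d) <= 1 by rewrite normcX exprn_ile1 ?normc_ge0.
rewrite (_ : (fun n => _) = (fun n => (cpown d s)^-1 *
    series (fun k => (z ^+ d) ^+ k.+1 / cpown k.+1 s : R[i]^o) (n %/ d)%N)).
  by apply: cvgn_mull; exact: cvg_comp (cvg_divn d0) (Li_cvg zd1 s1).
apply/funext => n /=.
rewrite (sum_dvdn (fun i => z ^+ i / cpown i s)) // /series /= big_mkord.
rewrite mulr_sumr; apply: eq_bigr => j _; rewrite exprM.
rewrite !cpownE natrM cpowM ?ltr0n //.
by move: (cpow _ s) (cpow _ s) => P Q; rewrite invfM; ring.
Qed.

(** The coprimality condition is written as a sum of Moebius values over the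
    common divisors of [n] and [k]; only finitely many series are combined. *)
Lemma coprime_series_cvg z s (k : nat) : (0 < k)%N -> normc z <= 1 ->
  1 < complex.Re s ->
  (fun n => \sum_(i < n | coprime i.+1 k) z ^+ i.+1 / cpown i.+1 s : R[i]^o)
    @ \oo -->
  (\sum_(d <- divisors k) (mobius d)%:~R / cpown d s * Li (z ^+ d) s : R[i]^o).
Proof.
move=> k0 z1 s1.
rewrite big_seq_cond.
under [X in _ --> X]eq_bigr do rewrite -mulrA.
rewrite (_ : (fun n => _) = (fun n => \sum_(d <- divisors k |
     (d \in divisors k) && true) (mobius d)%:~R *
       (\sum_(i < n | (d %| i.+1)%N) z ^+ i.+1 / cpown i.+1 s) : R[i]^o)).
  apply: cvgn_sum => d; rewrite andbT -dvdn_divisors // => dk.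
  apply: cvgn_mull; apply: Li_expr_cvg => //; exact: dvdn_gt0 dk.
apply/funext => n; rewrite -big_seq_cond.
under [RHS]eq_bigr do rewrite big_mkcond mulr_sumr.
rewrite exchange_big /= big_mkcond; apply: eq_bigr => i _ /=.
transitivity ((coprime i.+1 k)%:R%:~R * (z ^+ i.+1 / cpown i.+1 s)).
  by case: coprime; rewrite ?mul1r ?mul0r.
rewrite -sum_mobius_coprime // rmorph_sum /= mulr_suml big_mkcond /=.
by apply: eq_bigr => d _; case: ifP; rewrite ?mulr0.
Qed.

End CoprimeSeries.

(** * Summation over residue classes *)

Section Progressions.
Variable R : realType.
Implicit Types (s z : R[i]).

(** Apply the expansion with [y = x h / k] to each [h] and combine linearly: the
    powers of [k] come from [j k + x h = k (j + x h / k)]. The signed shift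
    [x h] covers both the residues [h] and [- h]. *)
Lemma sum_shifted_Lerch z s (k : nat) (r : seq nat) (P : pred nat)
    (w : nat -> R[i]) (x : nat -> R) :
  (0 < k)%N -> normc z <= 1 -> 1 < complex.Re s ->
  (forall h, P h -> `|x h| < k%:R) ->
  exists2 l : R[i]^o,
    (fun n => \sum_(j < n) \sum_(h <- r | P h)
       z ^+ j.+1 * w h * cpow (j.+1%:R * k%:R + x h) (- s) : R[i]^o)
      @ \oo --> l &
    series (fun m => binom_coef m s * Li z (s + m%:R) / cpown k (s + m%:R) *
       \sum_(h <- r | P h) w h * (x h)%:C ^+ m : R[i]^o) @ \oo --> l.
Proof.
move=> k0 z1 s1 xk.
have kR : 0 < k%:R :> R by rewrite ltr0n.
pose y h := x h / k%:R.
have y1 h : P h -> `|y h| < 1.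
  move=> Ph; rewrite normrM normfV (ger0_norm (ltW kR)) ltr_pdivrMr // mul1r.
  exact: xk.
have L h : exists l : R[i]^o, P h ->
    series (fun j => z ^+ j.+1 * cpow (j.+1%:R + y h) (- s) : R[i]^o)
      @ \oo --> l /\
    series (fun m => binom_coef m s * Li z (s + m%:R) * (y h)%:C ^+ m : R[i]^o)
      @ \oo --> l.
  case: (boolP (P h)) => [Ph|]; last by exists 0.
  by have [l l1 l2] := Lerch_expansion z1 s1 (y1 h Ph); exists l.
have [l lP] := choice L.
exists (\sum_(h <- r | P h) w h * cpow k%:R (- s) * l h).
  rewrite (_ : (fun n => _) = (fun n => \sum_(h <- r | P h)
     w h * cpow k%:R (- s) *
     series (fun j => z ^+ j.+1 * cpow (j.+1%:R + y h) (- s) : R[i]^o) n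
     : R[i]^o)).
    by apply: cvgn_sum => h Ph; apply: cvgn_mull; exact: (lP h Ph).1.
  apply/funext => n; rewrite exchange_big; apply: eq_bigr => h Ph.
  rewrite /series /= big_mkord mulr_sumr; apply: eq_bigr => j _.
  have jy : 0 < j.+1%:R + y h.
    have := y1 h Ph; rewrite ltr_norml => /andP[h1 _].
    have : 1 <= j.+1%:R :> R by rewrite ler1n.
    by lra.
  rewrite (_ : j.+1%:R * k%:R + x h = k%:R * (j.+1%:R + y h)); last first.
    by rewrite mulrDr /y mulrCA mulfV ?gt_eqF // mulr1 mulrC.
  by rewrite (cpowM _ kR jy); ring.
rewrite (_ : series _ = (fun n => \sum_(h <- r | P h)
     w h * cpow k%:R (- s) *
     series (fun m => binom_coef m s * Li z (s + m%:R) * (y h)%:C ^+ m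
       : R[i]^o) n : R[i]^o)).
  by apply: cvgn_sum => h Ph; apply: cvgn_mull; exact: (lP h Ph).2.
apply/funext => n; rewrite /series /=.
under [RHS]eq_bigr do rewrite mulr_sumr.
rewrite exchange_big; apply: eq_bigr => m _ /=; rewrite mulr_sumr.
apply: eq_bigr => h Ph.
rewrite cpownE cpowD (cpowr_nat _ kR) cpowN /y rmorphM fmorphV /=.
by move: (cpow _ s) => Q; rewrite exprMn exprVn invfM; ring.
Qed.

Lemma sum_nat_blocks (V : nmodType) (F : nat -> V) (n k : nat) :
  \sum_(i < n * k) F i = \sum_(j < n) \sum_(0 <= h < k) F (j * k + h)%N.
Proof.
rewrite -(big_mkord xpredT F) big_nat_mul big_mkord; apply: eq_bigr => j _.
rewrite -{1}[(j * k)%N]add0n big_addn mulSn addnK.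
by apply: eq_bigr => h _; rewrite addnC.
Qed.

Lemma cvg_predn_mulSn (k : nat) : (0 < k)%N ->
  (fun n => (n.+1 * k).-1) @ \oo --> \oo.
Proof.
move=> k0; apply/cvgnyPge => A; near=> n.
have An : (A <= n)%N by near: n; exact: nbhs_infty_ge.
rewrite -ltnS prednK ?muln_gt0 // (leq_trans _ (leq_pmulr _ k0)) // ltnS.
Unshelve. all: by end_near. Qed.

(** The index [i] of the series stands for the integer [i.+1], so cutting it at
    [(n.+1 * k).-1] leaves the integers below [n.+1 * k], in whole blocks of
    length [k]. The integer [0] may be added to the first block because it is
    not coprime to [k > 1]. *)
Lemma coprime_series_blocks z s (k : nat) : (1 < k)%N -> normc z <= 1 ->
  1 < complex.Re s ->
  (fun n => \sum_(j < n.+1) \sum_(0 <= h < k | coprime h k)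
       z ^+ (j * k + h) * cpow (j * k + h)%:R (- s) : R[i]^o) @ \oo -->
  (\sum_(d <- divisors k) (mobius d)%:~R / cpown d s * Li (z ^+ d) s : R[i]^o).
Proof.
move=> k1 z1 s1; have k0 : (0 < k)%N by exact: ltnW.
have := cvg_comp _ _ (cvg_predn_mulSn k0) (coprime_series_cvg k0 z1 s1).
rewrite (_ : (_ \o _) = (fun n =>
    \sum_(j < n.+1) \sum_(0 <= h < k | coprime h k)
       z ^+ (j * k + h) * cpow (j * k + h)%:R (- s) : R[i]^o)) //.
apply/funext => n /=.
pose F i := if coprime i k then z ^+ i / cpown i s else 0.
transitivity (\sum_(i < n.+1 * k) F i).
  have -> : (n.+1 * k = ((n.+1 * k).-1).+1)%N by rewrite prednK // muln_gt0.
  rewrite big_ord_recl /= {1}/F /coprime gcd0n gtn_eqF // add0r.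
  by rewrite big_mkcond /=; apply: eq_bigr.
rewrite sum_nat_blocks; apply: eq_bigr => j _.
rewrite [RHS]big_mkcond /=; apply: eq_bigr => h _.
by rewrite /F /coprime gcdnC gcdnMDl gcdnC cpownE cpowN.
Qed.

End Progressions.

Theorem theorem2 (R : realType) (s z : R[i]) (q k b : nat)
    (hs : 1 < complex.Re s) (hq : (1 <= q)%N) (hz : q.-primitive_root z)
    (hk : (2 <= k)%N) (hb : (0 < b)%N) (hkb : k = (b * q + 1)%N) :
  let lhs : R[i] :=
    \sum_(d <- divisors k) (mobius d)%:~R / cpown d s * Li (z ^+ d) s in
  let t1 : nat -> R[i]^o := fun m =>
    (-1) ^+ m * rising_coef m s * Li z (s + m%:R) / cpown k (s + m%:R)
    * \sum_(1 <= h < k.+1 | coprime h k) z ^+ h * h%:R ^+ m in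
  let t2 : nat -> R[i]^o := fun m =>
    rising_coef m s * Li z (s + m%:R) / cpown k (s + m%:R)
    * \sum_(1 <= h < k.+1 | coprime h k) z ^- h * h%:R ^+ m in
  (cvgn (series t1) /\
   lhs = \sum_(1 <= h < k.+1 | coprime h k) z ^+ h * cpown h (- s)
         + limn (series t1)) /\
  (cvgn (series t2) /\ lhs = limn (series t2)).
Proof.
move=> lhs t1 t2.
have k0 : (0 < k)%N by exact: ltnW.
have zq : z ^+ q = 1 by exact: prim_expr_order hz.
have zk : z ^+ k = z by rewrite hkb exprD expr1 mulnC exprM zq expr1n mul1r.
have z1 : normc z <= 1.
  have : normc z ^+ q = 1 by rewrite -normcX zq normc1.
  by move/eqP; rewrite (pexpr_eq1 hq (normc_ge0 z)) => /eqP ->.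
have z0 : z != 0.
  apply: contra_eq_neq zq => ->.
  by rewrite expr0n gtn_eqF // eq_sym oner_eq0.
have zjk (j : nat) : z ^+ (j * k) = z ^+ j by rewrite mulnC exprM zk.
have lc := coprime_series_blocks hk z1 hs.
(* Neither 0 nor k is coprime to k, so all ranges reduce to 0 < h < k. *)
have drop0 (F : nat -> R[i]) :
    \sum_(0 <= h < k | coprime h k) F h = \sum_(1 <= h < k | coprime h k) F h.
  by rewrite big_ltn_cond // /coprime gcd0n gtn_eqF.
have dropk (F : nat -> R[i]) :
    \sum_(1 <= h < k.+1 | coprime h k) F h =
    \sum_(1 <= h < k | coprime h k) F h.
  rewrite big_mkcond big_nat_recr //= {2}/coprime gcdnn gtn_eqF // addr0.
  by rewrite -big_mkcond.
pose Pr (h : nat) := (h < k)%N && coprime h k.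
have PrE (F : nat -> R[i]) :
    \sum_(1 <= h < k | Pr h) F h = \sum_(1 <= h < k | coprime h k) F h.
  rewrite big_nat_cond [RHS]big_nat_cond; apply: eq_bigl => h.
  by rewrite /Pr; case: (h < k)%N; rewrite ?andbF.
have natC (h : nat) : (h%:R : R)%:C = h%:R by rewrite rmorph_nat.
split.
  have xk (h : nat) : Pr h -> `|h%:R : R| < k%:R.
    by move=> /andP[hk' _]; rewrite normr_nat ltr_nat.
  have [l l1 l2] :=
    sum_shifted_Lerch (index_iota 1 k) (fun h => z ^+ h) k0 z1 hs xk.
  have t1E : series t1 @ \oo --> l.
    rewrite (_ : t1 = fun m =>
       binom_coef m s * Li z (s + m%:R) / cpown k (s + m%:R) *
       \sum_(1 <= h < k | Pr h) z ^+ h * (h%:R : R)%:C ^+ m); first exact: l2.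
    apply/funext => m; rewrite /t1 dropk -PrE; congr (_ * _).
    by apply: eq_bigr => h _; rewrite natC.
  split; first by apply/cvg_ex; exists l.
  rewrite (cvgn_limE t1E).
  apply: (cvgn_uniq lc).
  rewrite (_ : (fun n => _) = (fun n =>
    (\sum_(1 <= h < k.+1 | coprime h k) z ^+ h * cpown h (- s)) +
    \sum_(j < n) \sum_(1 <= h < k | Pr h)
       z ^+ j.+1 * z ^+ h * cpow (j.+1%:R * k%:R + h%:R) (- s) : R[i]^o)).
    apply: (@cvgD _ (R[i]^o : normedModType R[i])); [exact: cvg_cst|exact: l1].
  apply/funext => n; rewrite big_ord_recl /=; congr (_ + _).
    by rewrite drop0 dropk; apply: eq_bigr => h _; rewrite mul0n add0n.
  apply: eq_bigr => j _; rewrite drop0 -PrE; apply: eq_bigr => h _.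
  by rewrite /bump /= add1n exprD zjk natrD natrM.
have xk (h : nat) : Pr h -> `|- h%:R : R| < k%:R.
  by move=> /andP[hk' _]; rewrite normrN normr_nat ltr_nat.
have [l l1 l2] :=
  sum_shifted_Lerch (index_iota 1 k) (fun h => z ^- h) k0 z1 hs xk.
have t2E : series t2 @ \oo --> l.
  rewrite (_ : t2 = fun m =>
     binom_coef m s * Li z (s + m%:R) / cpown k (s + m%:R) *
     \sum_(1 <= h < k | Pr h) z ^- h * (- h%:R : R)%:C ^+ m); first exact: l2.
  apply/funext => m; rewrite /t2 dropk -PrE /binom_coef.
  have -> : \sum_(1 <= h < k | Pr h) z ^- h * (- h%:R : R)%:C ^+ m =
      (-1) ^+ m * \sum_(1 <= h < k | Pr h) z ^- h * h%:R ^+ m.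
    rewrite mulr_sumr; apply: eq_bigr => h _.
    by rewrite rmorphN /= natC -mulN1r exprMn mulrCA.
  have sgn : (-1) ^+ m * (-1) ^+ m = 1 :> R[i] by rewrite -expr2 sqrr_sign.
  move: (rising_coef m s) (Li _ _) (cpown _ _) (\sum_(_ <= _ < _ | _) _).
  move=> c L P S; by rewrite -[LHS]mul1r -[X in X * _ = _]sgn; ring.
split; first by apply/cvg_ex; exists l.
rewrite (cvgn_limE t2E).
apply: (cvgn_uniq lc).
rewrite -cvg_shiftS in l1.
apply: cvg_trans l1; apply: near_eq_cvg; near=> n.
(* Inside block j the residue h is renamed k - h, so that j k + (k - h) is
   (j + 1) k - h. *)
apply: eq_bigr => j _; rewrite drop0 PrE big_nat_rev big_nat_cond.
rewrite [RHS]big_nat_cond; apply: eq_big => [h|h].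
  case: (boolP (1 <= h < k)%N) => //= /andP[_ hk']; rewrite add1n subSS.
  rewrite /coprime; set e := (k - h)%N.
  have -> : k = (e + h)%N by rewrite /e subnK // ltnW.
  by rewrite gcdnDl gcdnDr gcdnC.
move=> /andP[/andP[h0 hk'] _]; rewrite add1n subSS.
have jE : (j * k + h = j.+1 * k - (k - h))%N by rewrite mulSn; lia.
have hE : (k - h <= j.+1 * k)%N by rewrite mulSn; lia.
rewrite jE -natrM -natrB //; congr (_ * _).
by rewrite [RHS]exprB ?unitfE // zjk.
Unshelve. all: by end_near. Qed.
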